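(* Let $S$ be a finite semigroup. If the semigroup determinant $\theta_S$ is nonzero (equivalently, if $\mathbb CS$ is a Frobenius algebra), then for each $s\in S$, the number of elements of $S$ fixed by left multiplication by $s$ equals the number of elements of $S$ fixed by right multiplication by $s$, that is, $|\{x\in S\mid sx=x\}|=|\{x\in S\mid xs=x\}|$.
   Context: For a finite semigroup $S$ with variables $\{x_s\mid s\in S\}$, the semigroup determinant $\theta_S\in\mathbb C[x_s\mid s\in S]$ is the determinant of the $S\times S$ matrix whose $(s,t)$-entry is $x_{st}$. A finite dimensional $\mathbb C$-algebra $A$ is Frobenius if it is unital and there is a linear map $\lambda\colon A\to\mathbb C$ such that $(a,b)\mapsto\lambda(ab)$ is a nondegenerate bilinear form. *)

(* Defs.v *)
From HB Require Import structures.
From mathcomp Require Import all_boot all_order all_algebra.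
From mathcomp Require Import complex reals.
From mathcomp Require Import mpoly.

Set Implicit Arguments.
Unset Strict Implicit.
Unset Printing Implicit Defensive.

Import GRing.Theory.
Local Open Scope ring_scope.

#[short(type="finSemigroupType")]
HB.structure Definition FinSemigroup := {G of Semigroup G & Finite G}.

(* Rows, columns and variables are all numbered by the same bijection          *)
(* enum_rank : S -> 'I_#|S| (inverse enum_val). Changing this numbering        *)
(* conjugates the matrix by a permutation and renames the variables.           *)
Definition semigroup_matrix (K : comNzRingType) (S : finSemigroupType) :
    'M[{mpoly K[#|S|]}]_#|S| :=
  \matrix_(i, j) 'X_(enum_rank (enum_val i * enum_val j : S)%g).

Definition semigroup_det (K : comNzRingType) (S : finSemigroupType) :
    {mpoly K[#|S|]} :=
  \det (semigroup_matrix K S).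

(* Not required to be unital, unlike the library's falgType: a semigroup       *)
(* algebra need not have an identity. The zero algebra is allowed.             *)
Record fdAlgebra (K : fieldType) := FdAlgebra {
  fdalg_space :> vectType K;
  fdalg_mul : {bilinear fdalg_space -> fdalg_space -> fdalg_space};
  fdalg_mulA : associative fdalg_mul
}.

Definition unital (K : fieldType) (A : fdAlgebra K) : Prop :=
  exists e : A, left_id e (fdalg_mul A) /\ right_id e (fdalg_mul A).

(* The library's sesquilinear.nondegenerate only covers hermitian forms.       *)
Definition nondegenerate_form (K : fieldType) (V : vectType K)
    (B : V -> V -> K) : Prop :=
  (forall a, (forall b, B a b = 0) -> a = 0) /\
  (forall b, (forall a, B a b = 0) -> b = 0).

Definition frobenius (K : fieldType) (A : fdAlgebra K) : Prop :=
  unital A /\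
  exists lambda : {linear A -> K^o},
    nondegenerate_form (fun a b : A => lambda (fdalg_mul A a b)).

Section SemigroupAlgebra.
Variables (K : fieldType) (S : finSemigroupType).

(* f represents the formal sum \sum_s (f s) s. *)
Definition salg_mul (f g : {ffun S -> K^o}) : {ffun S -> K^o} :=
  [ffun z => \sum_(x : S) \sum_(y : S | (x * y)%g == z) f x * g y].

Lemma salg_mul_bilinear :
  bilinear_for (GRing.Scale.Law.clone _ _ *:%R _)
    (GRing.Scale.Law.clone _ _ *:%R _) salg_mul.
Proof.
split=> [g|f] a u v; apply/ffunP=> z; rewrite !ffunE scaler_sumr -big_split.
  apply: eq_bigr => x _; rewrite scaler_sumr -big_split; apply: eq_bigr => y _.
  by rewrite !ffunE /= mulrDl /GRing.scale /= mulrA.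
apply: eq_bigr => x _; rewrite scaler_sumr -big_split; apply: eq_bigr => y _.
by rewrite !ffunE /= mulrDr /GRing.scale /= mulrCA.
Qed.

HB.instance Definition _ :=
  bilinear_isBilinear.Build K {ffun S -> K^o} {ffun S -> K^o} {ffun S -> K^o}
    _ _ salg_mul salg_mul_bilinear.

Lemma sum_fibers (P : pred S) (F : S -> S -> K) :
  \sum_(w | P w) \sum_x \sum_(y | (x * y)%g == w) F x y =
  \sum_x \sum_(y | P (x * y)%g) F x y.
Proof.
rewrite exchange_big; apply: eq_bigr => x _ /=.
rewrite (exchange_big_dep (fun y => P (x * y)%g)) /=; last by move=> w y + /eqP->.
apply: eq_bigr => y Pxy; rewrite (big_pred1 (x * y)%g) // => w.
by rewrite /= eq_sym; case: eqP => [->|_]; rewrite ?Pxy ?andbF.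
Qed.

Lemma salg_mulA : associative salg_mul.
Proof.
move=> f g h; apply/ffunP=> z; rewrite !ffunE.
transitivity (\sum_x \sum_y \sum_(t | (x * (y * t))%g == z) f x * g y * h t).
  apply: eq_bigr => x _; rewrite -(sum_fibers (fun w => (x * w)%g == z)).
  apply: eq_bigr => w _; rewrite ffunE mulr_sumr; apply: eq_bigr => y _.
  by rewrite mulr_sumr; apply: eq_bigr => t _; rewrite mulrA.
rewrite [RHS](exchange_big_dep predT) //=.
transitivity (\sum_t \sum_x \sum_(y | (x * y * t)%g == z) f x * g y * h t).
  rewrite exchange_big [RHS]exchange_big /=.
  under [RHS]eq_bigr => x _ do rewrite (exchange_big_dep predT) //=.
  rewrite [LHS]exchange_big; apply: eq_bigr => x _ /=; apply: eq_bigr => y _.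
  by apply: eq_bigl => t; rewrite mulgA.
apply: eq_bigr => t _; rewrite -(sum_fibers (fun w => (w * t)%g == z)).
apply: eq_bigr => w _; rewrite ffunE mulr_suml; apply: eq_bigr => x _.
by rewrite mulr_suml.
Qed.

Definition semigroup_algebra : fdAlgebra K := FdAlgebra salg_mulA.

End SemigroupAlgebra.

(* Main.v *)
(* For c : S -> K let M_c be the matrix with (x, y)-entry c(xy); these
   matrices are the specialisations of the matrix defining theta_S. Over an
   infinite field theta_S != 0 iff det M_c != 0 for some c, i.e. iff the
   linear extension of c makes (a, b) |-> c(ab) nondegenerate. Such a form
   forces a unit: the functional itself is c(e _) for some e, and then
   c((eb - b)d) = 0 for all d, so eb = b; likewise on the right. Finally,
   associativity says that M_c intertwines the matrix of right multiplication
   by s with the transpose of that of left multiplication, so the two have the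
   same trace, i.e. the same number of fixed points. *)

Require Import Defs.
From HB Require Import structures.
From mathcomp Require Import all_boot all_order all_algebra.
From mathcomp Require Import complex reals.
From mathcomp Require Import mpoly.

Set Implicit Arguments.
Unset Strict Implicit.
Unset Printing Implicit Defensive.

Import GRing.Theory Num.Theory.
Local Open Scope ring_scope.

(** * Nonzero multivariate polynomials have a nonzero value *)

Lemma muni_coef (R : nzRingType) n (p : {mpoly R[n.+1]}) (m : 'X_{1..n.+1}) :
  ((muni p)`_(m ord_max))@_[multinom m (widen_ord (leqnSn n) i) | i < n] =
  p@_m.
Proof.
rewrite muniE coef_sum raddf_sum.
(* Only the monomial [m] itself contributes, because a monomial is determined by its last exponent
   together with its first [n] exponents. *)
have term m' : ((p@_m' *: 'X_[[multinom m' (widen_ord (leqnSn n) i) | i < n]]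
    *: 'X^(m' ord_max))`_(m ord_max))@_[multinom m (widen_ord (leqnSn n) i)
    | i < n] = p@_m' *+ (m' == m).
  rewrite coefZ coefXn; case: eqP => [eq_last | ne_last]; last first.
    by rewrite mulr0 mcoeff0; case: eqP => // eq_m; case: ne_last; rewrite eq_m.
  rewrite mulr1 mcoeffZ mcoeffX mulr_natr; congr (_ *+ nat_of_bool _).
  apply/eqP/eqP => [/mnmP eq_init | -> //]; apply/mnmP => i.
  case: (unliftP ord_max i) => [j -> | -> //].
  have := eq_init j; rewrite !mnmE.
  by have -> : widen_ord (leqnSn n) j = lift ord_max j
    by apply/val_inj; rewrite /= /bump leqNgt ltn_ord.
rewrite (eq_bigr _ (fun m' _ => term m')) {term}.
have [m_p | m'_p] := boolP (m \in msupp p).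
  by rewrite (bigD1_seq m) ?msupp_uniq //= eqxx big1 ?addr0 // => m' /negPf ->.
rewrite big_seq big1 => [|m' m'p]; first by rewrite memN_msupp_eq0.
by case: eqP => // eq_m; rewrite -eq_m m'p in m'_p.
Qed.

Lemma muni_eq0 (R : nzRingType) n (p : {mpoly R[n.+1]}) :
  (muni p == 0) = (p == 0).
Proof.
apply/eqP/eqP => [p0 | ->]; last exact: muni0.
by apply/mpolyP=> m; rewrite -muni_coef p0 coef0 !mcoeff0.
Qed.

Lemma meval_muni (R : comNzRingType) n (p : {mpoly R[n.+1]})
    (v : 'I_n.+1 -> R) :
  p.@[v] =
  (map_poly (meval (v \o widen_ord (leqnSn n))) (muni p)).[v ord_max].
Proof.
rewrite muniE raddf_sum horner_sum mevalE; apply: eq_bigr => m _ /=.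
rewrite map_polyZ /= map_polyXn hornerZ hornerXn mevalZ mevalX -mulrA.
rewrite big_ord_recr /=; congr (_ * (_ * _)).
by apply: eq_bigr => i _; rewrite mnmE.
Qed.

(** In characteristic 0 the integers below [size p] are distinct points of [K], one more than the
    degree, so they cannot all be roots. *)
Lemma exists_nonroot (K : numDomainType) (p : {poly K}) :
  p != 0 -> exists x, p.[x] != 0.
Proof.
move=> p_neq0; pose rs := [seq (i%:R : K) | i <- iota 0 (size p)].
have uniq_rs : uniq rs.
  by rewrite map_inj_uniq ?iota_uniq // => i j /eqP; rewrite eqr_nat => /eqP.
have : ~~ all (root p) rs.
  apply/negP => /(max_poly_roots p_neq0)/(_ uniq_rs).
  by rewrite size_map size_iota ltnn.
by case/allPn => x _ nrx; exists x.
Qed.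

(** Induction on the number of variables: [muni p] is a polynomial in the last variable. A point [v]
    where its leading coefficient is nonzero keeps the specialised univariate polynomial nonzero,
    and a nonroot of that supplies the last coordinate. *)
Lemma exists_meval_neq0 (K : numDomainType) n (p : {mpoly K[n]}) :
  p != 0 -> exists v, p.@[v] != 0.
Proof.
elim: n p => [|n IHn] p p_neq0.
  exists (fun=> 0); rewrite [p]nvar0_mpolyC mevalC.
  by apply: contraNneq p_neq0 => p0; rewrite [p]nvar0_mpolyC p0.
have /IHn[v v_neq0] : lead_coef (muni p) != 0 by rewrite lead_coef_eq0 muni_eq0.
have : map_poly (meval v) (muni p) != 0.
  apply: contraNneq v_neq0 => q0.
  by rewrite lead_coefE -(coef_map (meval v)) q0 coef0.
case/exists_nonroot => x x_neq0.
(* This is [v] extended by the last coordinate [x]. *)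
exists (fun i => if unlift ord_max i is Some j then v j else x).
rewrite meval_muni unlift_none (eq_map_poly (g := meval v)) // => q.
apply: meval_eq => i /=.
have -> : widen_ord (leqnSn n) i = lift ord_max i
  by apply/val_inj; rewrite /= /bump leqNgt ltn_ord.
by rewrite liftK.
Qed.

(** * A nondegenerate associative form forces a unit *)

Section FrobeniusUnit.
Variable K : fieldType.

(** [V] and its dual have the same finite dimension. *)
Lemma inj_dual_surj (V : vectType K) (phi : {linear V -> 'Hom(V, K^o)}) :
  injective phi -> forall f, exists a, phi a = f.
Proof.
move=> inj_phi f.
have ker0 : lker (linfun phi) == 0%VS.
  by apply/lker0P=> a b; rewrite !lfunE => /inj_phi.
have : f \in limg (linfun phi).
  have /eqP -> : limg (linfun phi) == fullv; last exact: memvf.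
  rewrite eqEdim subvf /= limg_dim_eq; last by rewrite (eqP ker0) capv0.
  by rewrite !dimvf /dim /= muln1.
by case/memv_imgP => a _ ->; exists a; rewrite lfunE.
Qed.

Variables (A : fdAlgebra K) (lambda : {linear A -> K^o}).
Local Notation mul := (fdalg_mul A).

Definition left_functional (a : A) : 'Hom(A, K^o) :=
  linfun (lambda \o mul a).

Lemma left_functional_linear : linear left_functional.
Proof.
move=> k a b; apply/lfunP=> c.
by rewrite add_lfunE scale_lfunE !lfunE /= linearPl linearP.
Qed.

HB.instance Definition _ :=
  GRing.isLinear.Build K A 'Hom(A, K^o) *:%R left_functional
    left_functional_linear.

Definition right_functional (b : A) : 'Hom(A, K^o) :=
  linfun (lambda \o applyr mul b).

Lemma right_functional_linear : linear right_functional.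
Proof.
move=> k a b; apply/lfunP=> c.
by rewrite add_lfunE scale_lfunE !lfunE /= linearPr linearP.
Qed.

HB.instance Definition _ :=
  GRing.isLinear.Build K A 'Hom(A, K^o) *:%R right_functional
    right_functional_linear.

Lemma nondegenerate_unital :
  nondegenerate_form (fun a b : A => lambda (mul a b)) -> unital A.
Proof.
case=> nondeg_l nondeg_r.
have [|e e_l] := @inj_dual_surj A left_functional _ (linfun lambda).
  apply: raddf_inj => a a0; apply: nondeg_l => b.
  by have /lfunP/(_ b) := a0; rewrite lfunE zero_lfunE.
have [|e' e_r] := @inj_dual_surj A right_functional _ (linfun lambda).
  apply: raddf_inj => a a0; apply: nondeg_r => b.
  by have /lfunP/(_ b) := a0; rewrite lfunE zero_lfunE.
have lam_l b : lambda (mul e b) = lambda b.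
  by have /lfunP/(_ b) := e_l; rewrite !lfunE.
have lam_r b : lambda (mul b e') = lambda b.
  by have /lfunP/(_ b) := e_r; rewrite !lfunE.
have idl : left_id e mul.
  move=> b; apply/eqP; rewrite -subr_eq0; apply/eqP/nondeg_l => c.
  by rewrite linearBl linearB /= -fdalg_mulA lam_l subrr.
have idr : right_id e' mul.
  move=> b; apply/eqP; rewrite -subr_eq0; apply/eqP/nondeg_r => c.
  by rewrite linearBr linearB /= fdalg_mulA lam_r subrr.
(* The left unit and the right unit coincide: [e = mul e e' = e']. *)
by exists e; split=> //; rewrite -(idr e) idl.
Qed.

End FrobeniusUnit.

(** * Specialisations of the semigroup determinant *)

Section SemigroupForm.
Variable S : finSemigroupType.

Definition form_matrix (R : Type) (c : S -> R) : 'M[R]_#|S| :=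
  \matrix_(i, j) c (enum_val i * enum_val j)%g.

Lemma semigroup_det_neq0P (K : numDomainType) :
  semigroup_det K S != 0 <-> exists c : S -> K, \det (form_matrix c) != 0.
Proof.
(* Evaluation is a ring morphism, so it commutes with the determinant. *)
have evalE v : (semigroup_det K S).@[v] = \det (form_matrix (v \o enum_rank)).
  rewrite /semigroup_det -(det_map_mx (meval v)); congr (\det _).
  by apply/matrixP=> i j; rewrite !mxE /= mevalXU.
split=> [/exists_meval_neq0[v] | [c c_neq0]].
  by rewrite evalE => v_neq0; exists (v \o enum_rank).
apply: contraNneq c_neq0 => det0.
have <- : (semigroup_det K S).@[c \o enum_val] = \det (form_matrix c).
  rewrite evalE; congr (\det _).
  by apply/matrixP=> i j; rewrite !mxE /= enum_rankK.
by rewrite det0 meval0.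
Qed.

(** * Traces and fixed points *)

Section Trace.
Variable (R : idomainType).

(** The adjugate replaces the inverse over a domain: with [d = \det M] and [N = \adj M], d tr A =
    tr(AMN) = tr(MBN) = tr(BNM) = d tr B, and [d] cancels. *)
Lemma mxtrace_intertwine n (M A B : 'M[R]_n) :
  \det M != 0 -> A *m M = M *m B -> \tr A = \tr B.
Proof.
move=> /mulfI inj_det AM; apply: inj_det.
rewrite -!mxtraceZ -!mul_mx_scalar -{1}mul_mx_adj -mul_adj_mx !mulmxA AM.
by rewrite -(mulmxA M) mxtrace_mulC.
Qed.

(** This is the operator f |-> f \o h on column vectors, so multiplying by it on the left reindexes
    rows along [h]. *)
Definition fun_matrix (h : S -> S) : 'M[R]_#|S| :=
  \matrix_(i, j) (h (enum_val i) == enum_val j)%:R.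

Lemma mxtrace_fun_matrix (h : S -> S) :
  \tr (fun_matrix h) = #|[set x | h x == x]|%:R.
Proof.
rewrite /mxtrace (reindex enum_rank) /=; last first.
  by apply: onW_bij; apply: enum_rank_bij.
under eq_bigr do rewrite mxE enum_rankK.
by rewrite -natr_sum -big_mkcond sum1dep_card.
Qed.

Lemma fun_matrix_mul (h : S -> S) (F : S -> 'I_#|S| -> R) :
  fun_matrix h *m (\matrix_(i, j) F (enum_val i) j) =
  \matrix_(i, j) F (h (enum_val i)) j.
Proof.
apply/matrixP=> i j; rewrite !mxE (bigD1 (enum_rank (h (enum_val i)))) //=.
rewrite !mxE enum_rankK eqxx mul1r big1 ?addr0 // => k ne_k.
rewrite !mxE; case: eqP => [eq_k | _]; last by rewrite mul0r.
by rewrite eq_k enum_valK eqxx in ne_k.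
Qed.

(* Both products have (x, y)-entry c(x s y). *)
Lemma form_matrix_intertwine (c : S -> R) (s : S) :
  fun_matrix (fun x => x * s)%g *m form_matrix c =
  form_matrix c *m (fun_matrix (fun x => s * x)%g)^T.
Proof.
rewrite [LHS](fun_matrix_mul _ (fun x j => c (x * enum_val j)%g)).
(* Transposing moves the second [fun_matrix] to the left, where it again acts by reindexing rows. *)
apply: trmx_inj; rewrite [RHS]trmx_mul trmxK.
have -> : (form_matrix c)^T = \matrix_(i, j) c (enum_val j * enum_val i)%g.
  by apply/matrixP=> i j; rewrite !mxE.
rewrite (fun_matrix_mul _ (fun y j => c (enum_val j * y)%g)).
by apply/matrixP=> i j; rewrite !mxE mulgA.
Qed.

Lemma card_fix_mul (c : S -> R) (s : S) :
  \det (form_matrix c) != 0 ->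
  #|[set x : S | (s * x)%g == x]|%:R = #|[set x : S | (x * s)%g == x]|%:R :> R.
Proof.
move=> /mxtrace_intertwine/(_ (form_matrix_intertwine c s)).
by rewrite mxtrace_tr !mxtrace_fun_matrix.
Qed.

End Trace.

(** * Frobenius forms on the semigroup algebra *)

Section Frobenius.
Variable (K : fieldType).

Definition point (x : S) : {ffun S -> K^o} := [ffun z => (z == x)%:R].

Lemma linear_ffunE (lambda : {linear {ffun S -> K^o} -> K^o}) f :
  lambda f = \sum_x f x * lambda (point x).
Proof.
have {1}-> : f = \sum_x (f x : K) *: point x.
  apply/ffunP=> z; rewrite sum_ffunE (bigD1 z) //= !ffunE eqxx.
  rewrite big1 ?addr0 => [|x /negPf ne_x].
    by rewrite /GRing.scale /= mulr1.
  by rewrite !ffunE eq_sym ne_x /GRing.scale /= mulr0.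
by rewrite linear_sum; apply: eq_bigr => x _; rewrite linearZ.
Qed.

Definition coords (f : {ffun S -> K^o}) : 'rV[K]_#|S| :=
  \row_i f (enum_val i).

Lemma coords_inj0 f : coords f = 0 -> f = 0.
Proof.
move=> /rowP f0; apply/ffunP=> x.
by have := f0 (enum_rank x); rewrite !mxE enum_rankK ffunE.
Qed.

Lemma coords_point i : coords (point (enum_val i)) = delta_mx 0 i.
Proof.
by apply/rowP=> j; rewrite !mxE ffunE (inj_eq enum_val_inj).
Qed.

(** This identifies [form_matrix (lambda \o point)] as the Gram matrix of the form in the basis of
    points. *)
Lemma linear_salg_mul (lambda : {linear {ffun S -> K^o} -> K^o}) f g :
  lambda (salg_mul f g) =
  (coords f *m form_matrix (lambda \o point) *m (coords g)^T) 0 0.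
Proof.
rewrite linear_ffunE.
under eq_bigr do rewrite ffunE mulr_suml.
transitivity (\sum_x \sum_y f x * g y * lambda (point (x * y)%g)).
  rewrite -[RHS](sum_fibers predT); apply: eq_bigr => z _.
  apply: eq_bigr => x _.
  by rewrite mulr_suml; apply: eq_bigr => y /eqP->.
have reindexS (F : S -> K) : \sum_x F x = \sum_(i < #|S|) F (enum_val i).
  by rewrite (reindex _ (onW_bij _ (enum_val_bij S))).
rewrite reindexS; under eq_bigr do rewrite reindexS.
rewrite exchange_big mxE; apply: eq_bigr => j _; rewrite !mxE mulr_suml.
by apply: eq_bigr => i _; rewrite !mxE mulrAC.
Qed.

Lemma nondegenerate_salgP (lambda : {linear {ffun S -> K^o} -> K^o}) :
  nondegenerate_form (fun f g => lambda (salg_mul f g)) <->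
  \det (form_matrix (lambda \o point)) != 0.
Proof.
set M := form_matrix _; split=> [[nondeg _] | detM].
  apply/negP => /det0P[v v_neq0 vM].
  (* A left kernel vector of the Gram matrix is the coordinate vector of an element of the left
     radical. *)
  pose f : {ffun S -> K^o} := [ffun x => v 0 (enum_rank x)].
  have coords_f : coords f = v.
    by apply/rowP=> i; rewrite mxE ffunE enum_valK.
  have f0 : f = 0.
    by apply: nondeg => g; rewrite linear_salg_mul coords_f vM mul0mx mxE.
  by case/eqP: v_neq0; rewrite -coords_f f0; apply/rowP=> i; rewrite !mxE ffunE.
have unitM : M \in unitmx by rewrite unitmxE unitfE.
split=> [f f0 | g g0]; apply: coords_inj0.
  rewrite -[LHS](mulmxK unitM) -[RHS](mul0mx _ (invmx M)); congr (_ *m _).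
  (* Pairing with the basis points reads off the entries of [coords f *m M]. *)
  apply/rowP=> i; have := f0 (point (enum_val i)).
  by rewrite linear_salg_mul coords_point trmx_delta -colE !mxE.
apply: trmx_inj; rewrite -[LHS](mulKmx unitM) trmx0 -[RHS](mulmx0 _ (invmx M)).
congr (_ *m _); apply/colP=> i; have := g0 (point (enum_val i)).
by rewrite linear_salg_mul coords_point -mulmxA -rowE !mxE.
Qed.

Definition linear_extension (c : S -> K) (f : {ffun S -> K^o}) : K^o :=
  \sum_x f x * c x.

Lemma linear_extension_linear c : linear (linear_extension c).
Proof.
move=> k f g; rewrite /linear_extension scaler_sumr -big_split.
apply: eq_bigr => x _; rewrite !ffunE mulrDl.
by rewrite /GRing.scale /= mulrA.
Qed.

HB.instance Definition _ c :=
  GRing.isLinear.Build K {ffun S -> K^o} K^o *:%R (linear_extension c)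
    (linear_extension_linear c).

Lemma linear_extension_point c x : linear_extension c (point x) = c x.
Proof.
rewrite /linear_extension (bigD1 x) //= ffunE eqxx mul1r big1 ?addr0 // => z.
by rewrite ffunE => /negPf->; rewrite mul0r.
Qed.

(** Restriction to points and linear extension pass between functionals and functions on [S];
    nondegeneracy then supplies the unit. *)
Lemma frobenius_salgP :
  frobenius (semigroup_algebra K S) <->
  exists c : S -> K, \det (form_matrix c) != 0.
Proof.
split=> [[_ [lambda /nondegenerate_salgP]] | [c det_c]].
  by exists (lambda \o point).
have nondeg : nondegenerate_form
    (fun f g => linear_extension c (salg_mul f g)).
  apply/nondegenerate_salgP; congr (\det _ != 0): det_c.
  by apply/matrixP=> i j; rewrite !mxE /= linear_extension_point.
split; last by exists (linear_extension c).
exact: (@nondegenerate_unital K (semigroup_algebra K S) (linear_extension c)).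
Qed.

End Frobenius.
End SemigroupForm.

Theorem corollary2p4 (R : realType) (S : finSemigroupType) :
  (semigroup_det R[i] S != 0 <-> frobenius (semigroup_algebra R[i] S)) /\
  (semigroup_det R[i] S != 0 -> forall s : S,
     #|[set x : S | (s * x)%g == x]| = #|[set x : S | (x * s)%g == x]|).
Proof.
split.
  apply: iff_trans (iff_sym (frobenius_salgP _ _)).
  exact: semigroup_det_neq0P.
move=> /semigroup_det_neq0P[c det_c] s.
(* The counts agree as elements of [R[i]], hence as naturals, by characteristic 0. *)
by apply/eqP; rewrite -(eqr_nat R[i]); apply/eqP/(card_fix_mul s det_c).
Qed.
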